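(* Let $L$ be a Moufang loop, let $K\ge1$, and let $A\subseteq L$ be a finite $K$-approximate subloop. Then there exists a subset $X\subseteq A^2$ with $|X|\le K$ such that $A^2\subseteq\bigcup_{x\in X}(xA)A$. In particular, $A^2$ is covered by at most $K$ subsets, each contained in $A^{\langle4\rangle}$.
   Context: A loop is a set with a binary operation having a two-sided identity $1$ such that for all $a,b$ the equations $ax=b$ and $ya=b$ have unique solutions. A Moufang loop is a loop satisfying $(xy)(zx)=(x(yz))x$ for all $x,y,z$. For subsets $X,Y$ of a loop, $XY=\{xy:x\in X,y\in Y\}$, and $A^2=AA$. For $n\ge2$, $A^{\langle n\rangle}$ is the union of all subset products obtained from $n$ copies of $A$ using all possible bracketings; in particular $A^{\langle 3\rangle}=(AA)A\cup A(AA)$, and $A^{\langle 4\rangle}$ is the union of $((AA)A)A$, $(A(AA))A$, $(AA)(AA)$, $A((AA)A)$, $A(A(AA))$. A finite subset $A$ of a loop is a $K$-approximate subloop if $1\in A$, $A=A^{-1}$ and $|A^{\langle 3\rangle}|\le K|A|$. *)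

(* Defs.v *)
From HB Require Import structures.
From mathcomp Require Import all_boot all_order all_algebra finmap.
From mathcomp Require Import boolp classical_sets functions cardinality reals.

Set Implicit Arguments.
Unset Strict Implicit.
Unset Printing Implicit Defensive.

Local Open Scope classical_set_scope.
Local Open Scope group_scope.

HB.mixin Record UMagma_isLoop L of UMagma L := {
  ldiv_unique : forall a b : L, exists! x : L, a * x = b;
  rdiv_unique : forall a b : L, exists! y : L, y * a = b
}.

#[short(type="loopType")]
HB.structure Definition Loop := {L of UMagma_isLoop L & UMagma L}.

HB.mixin Record Loop_isMoufang L of Loop L := {
  moufang : forall x y z : L, (x * y) * (z * x) = (x * (y * z)) * x
}.

#[short(type="moufangLoopType")]
HB.structure Definition MoufangLoop := {L of Loop_isMoufang L & Loop L}.

Definition prodset (L : magmaType) (X Y : set L) : set L :=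
  [set x * y | x in X & y in Y].

(* An element of a general loop need not have a two-sided inverse; in a Moufang
   loop every element has exactly one, so this is the elementwise inverse. *)
Definition invset (L : umagmaType) (A : set L) : set L :=
  [set b | exists2 a, A a & a * b = 1 /\ b * a = 1].

Inductive bracketing : Type :=
| Leaf
| Node of bracketing & bracketing.

Fixpoint nleaves (t : bracketing) : nat :=
  match t with
  | Leaf => 1
  | Node t1 t2 => nleaves t1 + nleaves t2
  end%N.

Fixpoint bracket_prod (L : magmaType) (A : set L) (t : bracketing) : set L :=
  match t with
  | Leaf => A
  | Node t1 t2 => prodset (bracket_prod A t1) (bracket_prod A t2)
  end.

(* The set A^<n>, intended for n >= 2 (it is A for n = 1, empty for n = 0). *)
Definition bracket_pow (L : magmaType) (A : set L) (n : nat) : set L :=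
  \bigcup_(t in [set t | nleaves t = n]) bracket_prod A t.

(* Cardinality of a set known to be finite (0 on infinite sets). *)
Definition ncard (T : choiceType) (A : set T) : nat := #|` fset_set A|%fset.

Definition approximate_subloop (R : realType) (L : loopType) (K : R)
    (A : set L) : Prop :=
  [/\ finite_set A, A 1, A = invset A &
      ((ncard (bracket_pow A 3))%:R <= K * (ncard A)%:R)%R].

(* Main.v *)
Require Import Defs.
From HB Require Import structures.
From mathcomp Require Import all_boot all_order all_algebra finmap.
From mathcomp Require Import boolp classical_sets functions cardinality reals.

(** Ruzsa covering: take [X] maximal in [A^2] with the translates [xA] pairwise
    disjoint. As left translations are injective, [|X| |A| = |XA| <= |(AA)A|],
    whence [|X| <= K]. By maximality every [y] in [A^2] satisfies [ya = xb] for
    some [x] in [X] and [a], [b] in [A], and the right inverse property of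
    Moufang loops gives [y = (ya)a^-1 = (xb)a^-1], which lies in [(xA)A]. *)

Import Order.TTheory GRing.Theory Num.Theory.

Local Open Scope classical_set_scope.
Local Open Scope ring_scope.

Lemma loop_mulgI (L : loopType) : right_injective (@monoid.mul L).
Proof.
move=> x y z eq_xy_xz; have [w [_ uniq_w]] := ldiv_unique x (x * z)%g.
by rewrite -(uniq_w y eq_xy_xz) -(uniq_w z erefl).
Qed.

Section MoufangIdentities.
Variable L : moufangLoopType.
Local Open Scope group_scope.
Implicit Types a b x y z : L.

Lemma moufang_flexible x z : x * (z * x) = (x * z) * x.
Proof. by have := moufang x 1 z; rewrite mulg1 mul1g. Qed.

(** Multiplying on the left by $b$ gives $b((ya)b) = (b(ya))b = (by)(ab) = by$, by flexibility and
    then the Moufang identity; cancelling $b$ concludes. *)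
Lemma moufang_mulgK a b y : a * b = 1 -> (y * a) * b = y.
Proof.
move=> ab1; apply: (loop_mulgI _ b).
by rewrite moufang_flexible -moufang ab1 mulg1.
Qed.

End MoufangIdentities.

Lemma finite_prodset (L : magmaType) (X Y : set L) :
  finite_set X -> finite_set Y -> finite_set (prodset X Y).
Proof. exact: finite_image2. Qed.

Lemma prodsetS (L : magmaType) (X X' Y Y' : set L) :
  X `<=` X' -> Y `<=` Y' -> prodset X Y `<=` prodset X' Y'.
Proof. by move=> sX sY _ [x /sX Xx [y /sY Yy <-]]; exists x => //; exists y. Qed.

Lemma finite_bracket_prod (L : magmaType) (A : set L) (t : bracketing) :
  finite_set A -> finite_set (bracket_prod A t).
Proof. by move=> finA; elim: t => //= t1 ? t2 ?; apply: finite_prodset. Qed.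

Lemma nleaves_gt0 (t : bracketing) : (0 < nleaves t)%N.
Proof. by elim: t => //= t1 t1_gt0 t2 _; rewrite addn_gt0 t1_gt0. Qed.

(** The bound is [<=] rather than [=] so that the induction applies to both subtrees: each loses at
    least the one leaf held by the other. *)
Lemma finite_nleaves (n : nat) : finite_set [set t | (nleaves t <= n)%N].
Proof.
elim: n => [|n IHn].
  by apply: (sub_finite_set _ (finite_set0 _)) => t /=; rewrite leqNgt nleaves_gt0.
apply: (sub_finite_set (B := [set Leaf] `|` [set Node t1 t2
  | t1 in [set t | (nleaves t <= n)%N] & t2 in [set t | (nleaves t <= n)%N]])).
  case=> [|t1 t2] /= le_t12; [by left | right].
  exists t1; last exists t2 => //; rewrite /= -ltnS (leq_trans _ le_t12)//.
    by rewrite -[ltnLHS]addn0 ltn_add2l nleaves_gt0.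
  by rewrite -[ltnLHS]add0n ltn_add2r nleaves_gt0.
by rewrite finite_setU; split; [exact: finite_set1 | exact: finite_image2].
Qed.

(** Since [ncard] is 0 on infinite sets, monotonicity of [ncard] into a bracket power requires this
    finiteness. *)
Lemma finite_bracket_pow (L : magmaType) (A : set L) (n : nat) :
  finite_set A -> finite_set (bracket_pow A n).
Proof.
move=> finA; apply: bigcup_finite => [|t _]; last exact: finite_bracket_prod.
by apply: (sub_finite_set _ (finite_nleaves n)) => t /= ->.
Qed.

Lemma ncard_le (T : choiceType) (A B : set T) :
  finite_set B -> A `<=` B -> (ncard A <= ncard B)%N.
Proof.
move=> finB sAB; apply/fsubset_leq_card.
by rewrite -fset_set_sub //; apply: sub_finite_set finB.
Qed.

Lemma ncard_image_le (T U : choiceType) (f : T -> U) (A : set T) :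
  finite_set A -> (ncard (f @` A) <= ncard A)%N.
Proof. by move=> finA; rewrite /ncard fset_set_image// leq_imfset_card. Qed.

Lemma card_fsetM (T U : choiceType) (A : {fset T}) (B : {fset U}) :
  #|` (A `*` B)%fset| = (#|` A| * #|` B|)%N.
Proof.
rewrite -(size_allpairs pair A B); apply/perm_size/uniq_perm => [//||[x y]].
  by apply: allpairs_uniq => // -[x y] [x' y'].
rewrite in_fsetM /=; apply/andP/allpairsP => [[Ax By]|[[x' y'] [Ax By [-> ->]]]//].
by exists (x, y).
Qed.

(** Multiplication is injective on $X \times A$: if $xa = yb$, the translates $xA$ and $yA$ meet, so
    $x = y$, and left cancellation gives $a = b$. *)
Lemma ncard_prodset (L : loopType) (X A : set L) :
  finite_set X -> finite_set A ->
  (forall x y, X x -> X y -> prodset [set x] A `&` prodset [set y] A !=set0 ->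
     x = y) ->
  ncard (prodset X A) = (ncard X * ncard A)%N.
Proof.
move=> finX finA disjXA.
have -> : prodset X A = (fun p => (p.1 * p.2)%g) @` (X `*` A).
  apply/seteqP; split=> [_ [x Xx [a Aa <-]]|_ [[x a] [/= Xx Aa] <-]].
    by exists (x, a).
  by exists x => //; exists a.
have finXA := finite_setX finX finA.
rewrite /ncard fset_set_image// card_in_imfset/=.
  by rewrite fset_setX// card_fsetM.
move=> [x a] [y b]; rewrite !in_fset_set// !inE /= => -[/= Xx Aa] [/= Xy Ab] eq_xayb.
have eq_xy : x = y.
  apply: disjXA => //; exists (x * a)%g; split; first by exists x => //; exists a.
  by exists y => //; exists b.
by move: eq_xayb; rewrite eq_xy => /loop_mulgI ->.
Qed.

(** Greedy selection along an enumeration of [S]: a new point is kept exactly when it is related to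
    no point chosen so far. *)
Lemma maximal_separated (T : choiceType) (r : T -> T -> Prop) (S : set T) :
  (forall x, r x x) -> (forall x y, r x y -> r y x) -> finite_set S ->
  exists X : set T, [/\ X `<=` S,
    forall x y, X x -> X y -> r x y -> x = y &
    forall y, S y -> exists2 x, X x & r y x].
Proof.
move=> r_refl r_sym /finite_seqP[s ->]; elim: s => [|z s [X [sXs sepX maxX]]].
  by exists set0; split.
have [[x Xx rzx]|far_z] := pselect (exists2 x, X x & r z x).
  exists X; split=> // [y /sXs /= ys|y /=]; first by rewrite inE ys orbT.
  by rewrite inE => /orP[/eqP->|/maxX//]; exists x.
exists (z |` X); split=> [y [->|/sXs /= ys]|x y|y /=].
- by rewrite /= mem_head.
- by rewrite /= inE ys orbT.
- move=> [->|Xx] [->|Xy] // rxy; last exact: sepX.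
    by case: far_z; exists y.
  by case: far_z; exists x => //; apply: r_sym.
- rewrite inE => /orP[/eqP->|/maxX[x Xx ryx]]; first by exists z => //; left.
  by exists x => //; right.
Qed.

Lemma bracket_prod_sub_pow (L : magmaType) (A : set L) (t : bracketing) :
  bracket_prod A t `<=` bracket_pow A (nleaves t).
Proof. by move=> x Ax; exists t. Qed.

Lemma approximate_subloop_covering (R : realType) (L : moufangLoopType) (K : R)
    (A : set L) :
  approximate_subloop K A ->
  exists X : set L,
    [/\ X `<=` prodset A A,
        finite_set X,
        (ncard X)%:R <= K &
        prodset A A `<=` \bigcup_(x in X) prodset (prodset [set x] A) A].
Proof.
move=> [finA A1 invA leAK]; have finAA := finite_prodset _ _ _ finA finA.
(* Separated for [r] means having pairwise disjoint translates. *)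
pose r x y := prodset [set x] A `&` prodset [set y] A !=set0.
have r_refl x : r x x.
  by exists (x * 1)%g; split; exists x => //; exists 1%g.
have r_sym x y : r x y -> r y x by rewrite /r setIC.
have [X [sXAA sepX maxX]] := maximal_separated _ _ _ r_refl r_sym finAA.
have finX := sub_finite_set sXAA finAA.
exists X; split=> //; last first.
  move=> y /maxX[x Xx [_ [[_ -> [a Aa <-]] [_ -> [b Ab eq_xbya]]]]].
  (* Symmetry of [A] supplies a right inverse [a'] of [a] inside [A], so $y = (ya)a' = (xb)a'$. *)
  have : invset A a by rewrite -invA.
  move=> [a' Aa' [_ aa'1]]; exists x => //.
  exists (x * b)%g; first by exists x => //; exists b.
  by exists a' => //; rewrite eq_xbya moufang_mulgK.
have A_gt0 : (0 < ncard A)%N.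
  by rewrite cardfs_gt0; apply/fset0Pn; exists 1%g; rewrite in_fset_set// inE.
(* Scaled by $|A| > 0$, the goal becomes $|X||A| \le K|A|$, and disjointness turns the left side
   into $|XA|$. *)
rewrite -(ler_pM2r (_ : 0 < (ncard A)%:R)) ?ltr0n// -natrM.
apply: le_trans leAK; rewrite ler_nat -ncard_prodset//.
apply: ncard_le; first exact: finite_bracket_pow.
apply: subset_trans (bracket_prod_sub_pow _ _ (Node (Node Leaf Leaf) Leaf)).
exact: prodsetS.
Qed.

Theorem corollary3p15 (R : realType) (L : moufangLoopType) (K : R) (hK : 1 <= K)
    (A : set L) (hA : approximate_subloop K A) :
  (exists X : set L,
     [/\ X `<=` prodset A A,
         finite_set X,
         (ncard X)%:R <= K &
         prodset A A `<=` \bigcup_(x in X) prodset (prodset [set x] A) A])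
  /\
  (exists F : set (set L),
     [/\ finite_set F,
         (ncard F)%:R <= K,
         prodset A A `<=` \bigcup_(B in F) B &
         forall B, F B -> B `<=` bracket_pow A 4]).
Proof.
have [X [sXAA finX leXK covX]] := approximate_subloop_covering _ _ _ _ hA.
split; first by exists X.
(* Distinct $x$ may give the same set $(xA)A$, so the family has at most $|X|$ members. *)
exists ((fun x => prodset (prodset [set x] A) A) @` X); split.
- exact: finite_image.
- by apply: le_trans leXK; rewrite ler_nat; apply: ncard_image_le.
- by rewrite bigcup_image.
- move=> _ [x Xx <-].
  (* As $x \in AA$, the set $(xA)A$ lies in the bracketing $((AA)A)A$. *)
  apply: subset_trans
    (bracket_prod_sub_pow _ _ (Node (Node (Node Leaf Leaf) Leaf) Leaf)).
  by do 2![apply: prodsetS => //] => _ ->; apply: sXAA.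
Qed.
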